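(* Let $b\ge 0$ and $s,k>0$ be integers such that $b+s$ is odd and $$D=D(b,s,k)=(4bs+1)^k+\bigl(b(4bs+1)^k+s\bigr)^2$$ is squarefree. If $41\cdot 61\cdot 175\cdot 1861$ divides $b$, then $h(D)>1$ unless $b=0$ and $s=1$.
   Context: For a squarefree integer $D>1$, $h(D)$ denotes the class number of the real quadratic field $\mathbb{Q}(\sqrt D)$. (Every integer divides $0$, so $b=0$ is allowed.) *)

(* Defs.v *)
From HB Require Import structures.
From mathcomp Require Import all_boot all_order all_algebra all_field.
From mathcomp Require Import finmap.
From mathcomp Require Import boolp classical_sets functions cardinality.

Set Implicit Arguments.
Unset Strict Implicit.
Unset Printing Implicit Defensive.

Import Order.TTheory GRing.Theory Num.Theory.

Local Open Scope classical_set_scope.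
Local Open Scope ring_scope.

Definition squarefree (n : nat) : Prop :=
  forall d : nat, (d ^ 2 %| n)%N -> d = 1%N.

(* Number fields are given as subsets of the algebraic numbers. *)
Definition quadfield (D : nat) : set algC :=
  [set z | exists x y : rat, z = ratr x + ratr y * sqrtC D%:R].

Section ClassNumber.
Variable K : set algC.

Definition ring_of_integers : set algC := [set z | K z /\ z \in Aint].

Definition fractional_ideal (I : set algC) : Prop :=
  [/\ I `<=` K,
      exists2 x, I x & x != 0,
      forall x y, I x -> I y -> I (x + y),
      forall a x, ring_of_integers a -> I x -> I (a * x)
    & exists d, [/\ ring_of_integers d, d != 0 &
                    forall x, I x -> ring_of_integers (d * x)]].

(* The coset of I modulo the group of principal fractional ideals: since
   (a) * I = a I, it consists of the ideals a I with a a nonzero element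
   of K. *)
Definition ideal_class (I : set algC) : set (set algC) :=
  [set J | exists a, [/\ K a, a != 0 & J = [set a * x | x in I]]].

Definition class_group : set (set (set algC)) :=
  [set C | exists2 I, fractional_ideal I & C = ideal_class I].

(* fset_set A is the empty finite set when A is infinite, so 0 < class_number
   entails that class_group is finite. *)
Definition class_number : nat := #|` fset_set class_group|.

End ClassNumber.

(* Main.v *)
(** The hypotheses force D = 2 mod 4, D > 2, so that 2 ramifies in Q(sqrt D),
    with integers Z[sqrt D].  Put A = 4bs+1 and B = b A^k + s.  The elements
    B + sqrt D and 2bB+1 + 2b sqrt D have norms -A^k and A, and
    (B + sqrt D) (2bB+1 + 2b sqrt D)^k / A^k is a unit of norm -1.  Hence every
    positive unit of norm 1 is the square of a unit.  If the prime ideal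
    (2, sqrt D) were principal, generated by z, then z^2/2 would be such a
    unit, so that 2 would be a square in Q(sqrt D), which is absurd.  The class
    of this ideal is therefore nontrivial.  Finiteness of the class group
    follows from Hurwitz's argument: by Dirichlet approximation, every ideal
    class contains an integral ideal containing D!. *)

Require Import Defs.
From mathcomp Require Import all_boot all_order all_algebra all_field.
From mathcomp Require Import finmap boolp classical_sets functions cardinality.
From mathcomp Require Import zify ring lra.

Set Implicit Arguments.
Unset Strict Implicit.
Unset Printing Implicit Defensive.

Import Order.TTheory GRing.Theory Num.Theory.

(** * Units of norm -1 and Pell equations *)

Section Pell.
Local Open Scope ring_scope.

Lemma ltr_of_sqr (R : realDomainType) (x y : R) : 0 <= y -> x ^+ 2 < y ^+ 2 -> x < y.
Proof.
move=> y0; rewrite !ltNge; apply: contra => xy.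
by rewrite ler_pXn2r // nnegrE (le_trans y0).
Qed.

(* For e = a + b sqrt D with b least among the elements of norm -1, the last
   hypothesis holds because (u + v sqrt D) / e has norm -1, and the conclusion
   says that u + v sqrt D is at least e^2 = 2 a^2 + 1 + 2 a b sqrt D. *)
Lemma pell_neg_gap (D a b u v : int) : 0 < D -> 0 < a -> 0 < b -> 1 < u -> 0 <= v ->
  a ^+ 2 - D * b ^+ 2 = -1 -> u ^+ 2 - D * v ^+ 2 = 1 ->
  b <= `|u * b - v * a| -> 2 * a ^+ 2 < u.
Proof.
move=> D0 a0 b0 u1 v0 Na Nu.
have h1 : v * a < u * b.
  apply: ltr_of_sqr; first by nia.
  have -> : (u * b) ^+ 2 = (v * a) ^+ 2 + b ^+ 2 + v ^+ 2.
    rewrite !exprMn.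
    have -> : u ^+ 2 = 1 + D * v ^+ 2 by lia.
    have -> : a ^+ 2 = -1 + D * b ^+ 2 by lia.
    by ring.
  by nia.
rewrite ger0_norm; last by rewrite subr_ge0 ltW.
move=> h2.
have h3 : (v * a) ^+ 2 <= ((u - 1) * b) ^+ 2.
  have h4 : v * a <= (u - 1) * b by rewrite mulrBl mul1r; lia.
  have h5 : 0 <= v * a by rewrite mulr_ge0 // ltW.
  by rewrite ler_pXn2r // nnegrE (le_trans h5).
(* This is [h3] times [D] after substituting both norm equations; cancelling [u - 1] leaves
   [2 a^2 + 1 <= u]. *)
have h4 : (u ^+ 2 - 1) * a ^+ 2 <= (u - 1) ^+ 2 * (a ^+ 2 + 1).
  have -> : u ^+ 2 - 1 = D * v ^+ 2 by lia.
  have -> : a ^+ 2 + 1 = D * b ^+ 2 by lia.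
  have := ler_wpM2l (ltW D0) h3.
  by rewrite !exprMn; lia.
have h5 : (u - 1) * ((u + 1) * a ^+ 2) <= (u - 1) * ((u - 1) * (a ^+ 2 + 1)) by lia.
by move: h5; rewrite ler_pM2l; lia.
Qed.

(** The bounded term is the rational coordinate of [(u + v sqrt D) / e^2], where [e = a + b sqrt D]
    and [e^2 = U + V sqrt D] has norm 1. It equals [u U - D V v] with
    [(D V v)^2 = (u^2 - 1) (U^2 - 1)], which is compared with the squares of [u U] and
    [u (U - 1)]. *)
Lemma pell_sqr_descent (D a b u v : int) : 0 < D -> 0 < a -> 0 < b ->
  a ^+ 2 - D * b ^+ 2 = -1 -> u ^+ 2 - D * v ^+ 2 = 1 -> 0 <= v ->
  2 * a ^+ 2 < u ->
  0 < u * (2 * a ^+ 2 + 1) - 2 * D * v * a * b < u.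
Proof.
move=> D0 a0 b0 Na Nu v0 hu.
set U := 2 * a ^+ 2 + 1; set V := 2 * a * b.
have NU : U ^+ 2 - D * V ^+ 2 = 1.
  have e : D * b ^+ 2 = a ^+ 2 + 1 by lia.
  have -> : D * V ^+ 2 = 4 * a ^+ 2 * (D * b ^+ 2) by rewrite /V; ring.
  by rewrite e /U; ring.
have U1 : 1 < U by have := exprn_gt0 2 a0; rewrite /U; lia.
have V0 : 0 < V by rewrite /V !mulr_gt0.
have -> : u * U - 2 * D * v * a * b = u * U - D * V * v by rewrite /V; ring.
have hU : U <= u by rewrite /U; lia.
have e : (D * V * v) ^+ 2 = (u ^+ 2 - 1) * (U ^+ 2 - 1).
  have -> : u ^+ 2 - 1 = D * v ^+ 2 by lia.
  have -> : U ^+ 2 - 1 = D * V ^+ 2 by lia.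
  by ring.
apply/andP; split.
  rewrite subr_gt0; apply: ltr_of_sqr; first by rewrite mulr_ge0 //; lia.
  have u2 : 1 < u ^+ 2 by rewrite exprn_egt1 //; lia.
  have U2 : 0 < U ^+ 2 by rewrite exprn_gt0 //; lia.
  by rewrite e exprMn; move: (u ^+ 2) (U ^+ 2) u2 U2 => c d; lia.
suff : u * (U - 1) < D * V * v by lia.
apply: ltr_of_sqr; first by rewrite !mulr_ge0 // ltW.
rewrite e.
have uu : u <= u ^+ 2 by rewrite ler_eXnr //; lia.
have : 0 < (U - 1) * (2 * u ^+ 2 - U - 1) by apply: mulr_gt0; lia.
lia.
Qed.

(* Descent: divide by the square of the least unit of norm -1 above 1. *)
Lemma pell_sqr (D a b u v : int) : 1 < D ->
  a ^+ 2 - D * b ^+ 2 = -1 -> u ^+ 2 - D * v ^+ 2 = 1 -> 0 < u ->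
  exists c d : int, u = c ^+ 2 + D * d ^+ 2 /\ v = 2 * c * d.
Proof.
move=> D1 Nab; have D0 : 0 < D by lia.
pose P n := `[< exists a : int, a ^+ 2 - D * n%:Z ^+ 2 = -1 >].
have exP : exists n, P n.
  by exists `|b|%N; apply/asboolP; exists a; rewrite abszE real_normK ?num_real.
case: (ex_minnP exP) => n /asboolP[a1 Na1] minn {exP Nab a b}.
pose a := `|a1|; pose b := n%:Z.
have Na : a ^+ 2 - D * b ^+ 2 = -1 by rewrite /a /b; lia.
have b0 : 0 < b.
  rewrite /b ltz_nat lt0n; apply/eqP => n0; move: Na1; rewrite n0.
  by have := sqr_ge0 a1; lia.
have a0 : 0 < a by rewrite /a normr_gt0; apply/eqP=> z; move: Na1; rewrite z /b; nia.
have minb (c d : int) : c ^+ 2 - D * d ^+ 2 = -1 -> b <= `|d|.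
  move=> Nc; have : P `|d|%N by apply/asboolP; exists c; lia.
  by move/minn; rewrite /b; lia.
have [m] := ubnP `|u|%N; elim: m u v => // m IH u v um Nu u0.
wlog v0 : v Nu / 0 <= v.
  move=> H; case: (lerP 0 v) => v0; first exact: H.
  have [||c [d [e1 e2]]] := H (- v); [lia| lia|].
  by exists c, (- d); rewrite sqrrN mulrN -e1 -e2 opprK.
have [u1|u1] := ltrP 1 u; last first.
  have e : u = 1 by lia.
  have ev : v = 0 by move: Nu; rewrite e; nia.
  by exists 1, 0; rewrite e ev; lia.
have h : b <= `|u * b - v * a|.
  apply: (minb (D * v * b - u * a)).
  have -> : (D * v * b - u * a) ^+ 2 - D * (u * b - v * a) ^+ 2 =
    (u ^+ 2 - D * v ^+ 2) * (a ^+ 2 - D * b ^+ 2) by ring.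
  by rewrite Nu Na.
have hu := pell_neg_gap D0 a0 b0 u1 v0 Na Nu h.
have := pell_sqr_descent D0 a0 b0 Na Nu v0 hu.
set w := (X in 0 < X < _) => /andP[w0 wu].
pose z := v * (2 * a ^+ 2 + 1) - 2 * u * a * b.
have eb : D * b ^+ 2 = a ^+ 2 + 1 by lia.
have Nw : w ^+ 2 - D * z ^+ 2 = 1.
  have -> : w ^+ 2 - D * z ^+ 2 = (u ^+ 2 - D * v ^+ 2) *
      ((2 * a ^+ 2 + 1) ^+ 2 - 4 * a ^+ 2 * (D * b ^+ 2)).
    by rewrite /w /z; ring.
  by rewrite Nu eb; ring.
have wm : (`|w| < m)%N.
  by rewrite -ltnS; apply: leq_trans um; clear -w0 wu; lia.
have [c [d [e1 e2]]] := IH w z wm Nw w0.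
(* Here [w + z sqrt D] is the quotient by [e^2], so its square root [c + d sqrt D] is multiplied by
   [e = a + b sqrt D]. *)
exists (c * a + D * d * b), (c * b + d * a); split.
- have -> : (c * a + D * d * b) ^+ 2 + D * (c * b + d * a) ^+ 2 =
    (c ^+ 2 + D * d ^+ 2) * (a ^+ 2 + D * b ^+ 2) + 2 * D * a * b * (2 * c * d) by ring.
  rewrite -e1 -e2 eb /w /z.
  have -> : (u * (2 * a ^+ 2 + 1) - 2 * D * v * a * b) * (a ^+ 2 + (a ^+ 2 + 1)) +
    2 * D * a * b * (v * (2 * a ^+ 2 + 1) - 2 * u * a * b) =
    u * ((2 * a ^+ 2 + 1) ^+ 2 - 4 * a ^+ 2 * (D * b ^+ 2)) by ring.
  by rewrite eb; ring.
- have -> : 2 * (c * a + D * d * b) * (c * b + d * a) =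
    (c ^+ 2 + D * d ^+ 2) * (2 * a * b) + (2 * c * d) * (a ^+ 2 + D * b ^+ 2) by ring.
  rewrite -e1 -e2 eb /w /z.
  have -> : (u * (2 * a ^+ 2 + 1) - 2 * D * v * a * b) * (2 * a * b) +
    (v * (2 * a ^+ 2 + 1) - 2 * u * a * b) * (a ^+ 2 + (a ^+ 2 + 1)) =
    v * ((2 * a ^+ 2 + 1) ^+ 2 - 4 * a ^+ 2 * (D * b ^+ 2)) by ring.
  by rewrite eb; ring.
Qed.

End Pell.

(** * Elements of norm 2 or -2, and solvability of the negative Pell equation *)

Lemma sqr_dvd_sqrn (n x y : nat) : 0 < y -> x ^ 2 = n * y ^ 2 -> exists q, n = q ^ 2.
Proof.
move=> y0 e.
have /dvdnP[q qE] : y %| x by rewrite -(@dvdn_pexp2r _ _ 2) // e dvdn_mull.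
exists q; apply/eqP; rewrite -(@eqn_pmul2r (y ^ 2)) ?expn_gt0 ?y0 //.
by rewrite -e qE expnMn.
Qed.

Section NormTwo.
Local Open Scope ring_scope.

Lemma sqr_eq_mul (n : nat) (x y : int) : y != 0 -> x ^+ 2 = n%:Z * y ^+ 2 ->
  exists q, n = (q ^ 2)%N.
Proof.
move=> y0 e; apply: (@sqr_dvd_sqrn n `|x| `|y|); first by rewrite absz_gt0.
by apply/eqP; rewrite -eqz_nat PoszM -!abszX !abszE e normrM !normrX; lia.
Qed.

(** In such an element [x = 2 z], and half its square is [(2 z^2 + m y^2) + 2 z y sqrt D], of norm
    1. By [pell_sqr] this is a square [(c + d sqrt D)^2], which makes 2 or [m] a perfect square. *)
Lemma pell_no_norm_two (m : nat) (a b x y : int) : (1 < m)%N ->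
  squarefree (2 * m) -> a ^+ 2 - (2 * m)%:Z * b ^+ 2 = -1 ->
  `|x ^+ 2 - (2 * m)%:Z * y ^+ 2| != 2.
Proof.
move=> m1 sqf Nab; apply/eqP => Nxy.
have [z xE] : exists z, x = 2 * z.
  have [z [e|e]] : exists z, x = 2 * z \/ x = 2 * z + 1 by exists (x %/ 2)%Z; lia.
    by exists z.
  by move: Nxy; rewrite e PoszM; lia.
subst x.
have n1 : `|2 * z ^+ 2 - m%:Z * y ^+ 2| = 1.
  move: Nxy; have -> : (2 * z) ^+ 2 - (2 * m)%:Z * y ^+ 2 =
    2 * (2 * z ^+ 2 - m%:Z * y ^+ 2) by rewrite PoszM; ring.
  by rewrite normrM; move: `|_ - _|; clear; lia.
have N1 : (2 * z ^+ 2 - m%:Z * y ^+ 2) ^+ 2 = 1.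
  by rewrite -real_normK ?num_real // n1.
have y0 : y != 0.
  apply/eqP => y0; move: n1; rewrite y0 expr0n mulr0 subr0.
  by move: (z ^+ 2); clear; lia.
have z0 : z != 0.
  apply/eqP => z0; move: n1; rewrite z0 expr0n mulr0 sub0r normrN normrM.
  have : 0 < `|y ^+ 2| by rewrite normr_gt0 expf_neq0.
  by move: `|_ ^+ 2| m1; clear; nia.
have [||||c [d [e1 e2]]] := @pell_sqr (2 * m)%:Z a b (2 * z ^+ 2 + m%:Z * y ^+ 2) (2 * z * y).
- by clear -m1; lia.
- exact: Nab.
- by rewrite -[RHS]N1 PoszM; ring.
- by apply: ltr_pwDl; [rewrite mulr_gt0 // exprn_even_gt0 | rewrite mulr_ge0 // sqr_ge0].
have e3 : c * d = z * y by apply: (@mulfI _ 2) => //; rewrite !mulrA e2.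
clear Nxy N1 Nab a b.
(* Since [c^2] and [2 m d^2] have the same sum and product as [2 z^2] and [m y^2], [c^2] is one of
   the latter two. *)
have : (c ^+ 2 - 2 * z ^+ 2) * (c ^+ 2 - m%:Z * y ^+ 2) = 0.
  have -> : (c ^+ 2 - 2 * z ^+ 2) * (c ^+ 2 - m%:Z * y ^+ 2) =
    c ^+ 2 * (c ^+ 2 - (2 * z ^+ 2 + m%:Z * y ^+ 2)) + (2 * m)%:Z * (z * y) ^+ 2.
    by rewrite PoszM; ring.
  by rewrite e1 -e3; ring.
move/eqP; rewrite mulf_eq0 !subr_eq0 => /orP[] /eqP /sqr_eq_mul[] // q qE.
  by move: qE; clear; case: q => [|[|q]] //; rewrite -mulnn; lia.
have q1 : q = 1%N by apply: sqf; rewrite -qE dvdn_mull.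
by move: m1; rewrite qE q1.
Qed.

(* P j + Q j sqrt D is the j-th power of 2bB+1 + 2b sqrt D, and P j + B Q j its
   image modulo A^k under sqrt D |-> B, which is a j-th power of 4bB+1. *)
Lemma dvdz_pell_orbit (A B D b : int) (k : nat) (P Q : nat -> int) :
  B ^+ 2 - D = - A ^+ k -> (A %| 4 * b * B + 1)%Z ->
  (P 0%N + B * Q 0%N = 1) ->
  (forall j, P j.+1 = (2 * b * B + 1) * P j + 2 * b * D * Q j) ->
  (forall j, Q j.+1 = 2 * b * P j + (2 * b * B + 1) * Q j) ->
  forall j, (j <= k)%N -> (A ^+ j %| P j + B * Q j)%Z.
Proof.
move=> NB Adiv PQ0 PS QS; elim=> [|j IH] jk; first by rewrite expr0 dvd1z.
have DE : D = B ^+ 2 + A ^+ k by rewrite -[A ^+ k]opprK -NB; ring.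
have -> : P j.+1 + B * Q j.+1 = (4 * b * B + 1) * (P j + B * Q j) + A ^+ k * (2 * b * Q j).
  by rewrite PS QS DE; ring.
apply: rpredD; last by rewrite -(subnK jk) exprD -mulrA mulrCA dvdz_mulr.
by rewrite exprS dvdz_mul // IH // ltnW.
Qed.

Lemma pell_neg_solvable (A b s : int) (k : nat) : (0 < k)%N -> A = 4 * b * s + 1 -> 0 < A ->
  exists x y : int, x ^+ 2 - (A ^+ k + (b * A ^+ k + s) ^+ 2) * y ^+ 2 = -1.
Proof.
move=> k0 AE A0; set B := b * A ^+ k + s; set D := _ + B ^+ 2.
have NB : B ^+ 2 - D = - A ^+ k by rewrite /D; ring.
pose r := 2 * b * B + 1.
(* [f j] holds the coordinates of the [j]-th power of [r + 2 b sqrt D], an element of norm [A]. *)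
pose f j := iter j (fun p : int * int => (r * p.1 + 2 * b * D * p.2, 2 * b * p.1 + r * p.2)) (1, 0).
pose P j := (f j).1; pose Q j := (f j).2.
have NA : r ^+ 2 - 4 * b ^+ 2 * D = A by rewrite /r /D /B [RHS]AE; ring.
have NPQ j : P j ^+ 2 - D * Q j ^+ 2 = A ^+ j.
  elim: j => [|j IH]; first by rewrite /P /Q /=; ring.
  rewrite [RHS]exprS -IH -[X in _ = X * _]NA /P /Q /=; ring.
(* Indeed [4 b B + 1 = 4 b^2 A^k + A]; a factor [A] comes out of [A^k] because [k > 0]. *)
have Adiv : (A %| 4 * b * B + 1)%Z.
  apply/dvdzP; exists (4 * b ^+ 2 * A ^+ k.-1 + 1).
  by rewrite [RHS]mulrDl mul1r -[X in _ = X + _]mulrA -exprSr prednK // [X in _ = _ + X]AE /B; ring.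
have PQ0 : P 0%N + B * Q 0%N = 1 by rewrite /P /Q /= mulr0 addr0.
have /dvdzP[y yE] := dvdz_pell_orbit NB Adiv PQ0 (fun=> erefl) (fun=> erefl) (leqnn k).
(* The coordinates of [(B + sqrt D) (P k + Q k sqrt D) / A^k]: as [D = B^2 + A^k], the rational one
   is [(B (P k + B Q k) + A^k Q k) / A^k]. *)
exists (B * y + Q k), y.
have Ak0 : A ^+ k ^+ 2 != 0 by rewrite !expf_neq0 // gt_eqF.
apply: (mulfI Ak0).
have PE : P k = y * A ^+ k - B * Q k by rewrite -yE addrK.
have := NPQ k; rewrite PE.
have -> : D = B ^+ 2 + A ^+ k by rewrite /D addrC.
move: (A ^+ k) => a e.
have -> : a ^+ 2 * -1 = - a * a by ring.
rewrite -{3}e; ring.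
Qed.

End NormTwo.

(** * The ring of integers of Q(sqrt D) *)

Section QuadField.
Local Open Scope ring_scope.
Local Open Scope classical_set_scope.

(** The square of the denominator of [r] is coprime to its numerator and divides [D] times the
    squared numerator, hence divides [D]. *)
Lemma rat_int_of_squarefree_mul (D : nat) (r : rat) (n : int) :
  squarefree D -> D%:R * r ^+ 2 = n%:~R -> exists w : int, r = w%:~R.
Proof.
move=> sqf e.
have q0 : (denq r)%:~R != 0 :> rat by rewrite intr_eq0 denq_neq0.
have e2 : D%:Z * numq r ^+ 2 = n * denq r ^+ 2.
  apply/eqP; rewrite -(eqr_int rat) !rmorphM /= ?rmorphXn /= -e numqE.
  by apply/eqP; ring.
have /sqf q1 : (`|denq r| ^ 2 %| D)%N.
  rewrite -(@Gauss_dvdl _ _ (`|numq r| ^ 2)); last first.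
    by rewrite coprimeXl // coprimeXr // coprime_sym coprime_num_den.
  apply/dvdnP; exists `|n|%N.
  by have := congr1 absz e2; rewrite !abszM -!mulnn mulnA.
exists (numq r); rewrite numqE.
have -> : denq r = 1 by rewrite -[LHS]gez0_abs ?q1.
by rewrite mulr1.
Qed.

Variable D : nat.
Hypothesis D4 : (D %% 4 = 2)%N.
Hypothesis sqf : squarefree D.

Local Notation s := (sqrtC D%:R : algC).
Local Notation K := (quadfield D).
Local Notation O := (ring_of_integers K).

Let s2 : s ^+ 2 = D%:R. Proof. exact: sqrtCK. Qed.

Definition quad (x y : rat) : algC := ratr x + ratr y * s.

Lemma sqrt_irrational (r : rat) : ratr r != s.
Proof.
apply/eqP => e.
have e2 : r ^+ 2 = D%:R.
  by apply: (fmorph_inj (@ratr algC)); rewrite ?rmorphXn /= e s2 rmorph_nat.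
have D0 : D%:R != 0 :> rat by rewrite pnatr_eq0; lia.
(* If [r^2 = D] then [D (r / D)^2 = 1], so [r / D] is an integer [w] with [D w^2 = 1], impossible as
   [D >= 2]. *)
have [|w wE] := @rat_int_of_squarefree_mul D (r / D%:R) 1 sqf.
  by rewrite exprMn e2; field.
have : D%:Z * w ^+ 2 = 1.
  apply/eqP; rewrite -(eqr_int rat) rmorphM ?rmorphXn /= -wE exprMn e2; apply/eqP.
  by rewrite /= pmulrn; field.
by nia.
Qed.

Lemma quad_inj x y x' y' : quad x y = quad x' y' -> x = x' /\ y = y'.
Proof.
move=> e; have e2 : ratr (y - y') * s = ratr (x' - x).
  rewrite !rmorphB /= mulrBl; apply/eqP; rewrite subr_eq addrAC eq_sym subr_eq.
  by rewrite -/(quad x' y') -e /quad addrC.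
have [y0|y0] := eqVneq (y - y') 0.
  move: e2; rewrite y0 rmorph0 mul0r => /esym/eqP; rewrite fmorph_eq0 subr_eq0 => /eqP ->.
  by split=> //; apply/eqP; rewrite -subr_eq0 y0.
have := sqrt_irrational ((x' - x) / (y - y')).
rewrite fmorph_div /= -e2 mulrAC divff ?mul1r ?eqxx //.
by rewrite fmorph_eq0.
Qed.

Lemma quadM x y x' y' :
  quad x y * quad x' y' = quad (x * x' + D%:R * y * y') (x * y' + y * x').
Proof.
rewrite /quad !rmorphD !rmorphM /= rmorph_nat; move: s s2 => t <-; ring.
Qed.

Lemma quadD x y x' y' : quad x y + quad x' y' = quad (x + x') (y + y').
Proof. rewrite /quad !rmorphD /=; ring. Qed.

Lemma quadN x y : - quad x y = quad (- x) (- y).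
Proof. rewrite /quad !rmorphN /=; ring. Qed.

Lemma quad_r x : quad x 0 = ratr x.
Proof. by rewrite /quad rmorph0 mul0r addr0. Qed.

Definition qnorm (R : pzRingType) (x y : R) : R := x ^+ 2 - D%:R * y ^+ 2.

Lemma qnorm_eq0 (x y : rat) : qnorm x y = 0 -> x = 0 /\ y = 0.
Proof.
move=> e; have: quad x y * quad x (- y) = 0.
  rewrite quadM; have -> : x * x + D%:R * y * - y = 0 by rewrite -e /qnorm; ring.
  have -> : x * - y + y * x = 0 by ring.
  by rewrite quad_r rmorph0.
have e0 : 0 = quad 0 0 by rewrite quad_r rmorph0.
move/eqP; rewrite mulf_eq0 => /orP[]/eqP; rewrite {1}e0 => /quad_inj[-> h] //.
by split=> //; apply/eqP; rewrite -oppr_eq0 h.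
Qed.

Lemma quadV x y : quad x y != 0 -> (quad x y)^-1 = quad (x / qnorm x y) (- y / qnorm x y).
Proof.
move=> q0.
have n0 : qnorm x y != 0.
  apply: contra q0 => /eqP/qnorm_eq0[-> ->].
  by rewrite quad_r rmorph0.
apply: (mulfI q0); rewrite divff // quadM.
have -> : x * (x / qnorm x y) + D%:R * y * (- y / qnorm x y) = 1.
  by move: n0; rewrite /qnorm => n0; field.
have -> : x * (- y / qnorm x y) + y * (x / qnorm x y) = 0 by ring.
by rewrite quad_r rmorph1.
Qed.

Lemma quadfieldM z w : K z -> K w -> K (z * w).
Proof.
move=> [x [y ->]] [x' [y' ->]].
by rewrite -!/(quad _ _) quadM; do 2!eexists.
Qed.

Lemma quadfieldV z : K z -> K z^-1.
Proof.
move=> [x [y ->]]; rewrite -/(quad _ _).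
have [->|/quadV->] := eqVneq (quad x y) 0; last by do 2!eexists.
by rewrite invr0; exists 0, 0; rewrite -/(quad 0 0) quad_r rmorph0.
Qed.

Definition qint (x y : int) : algC := quad x%:~R y%:~R.

Lemma qint_inj x y x' y' : qint x y = qint x' y' -> x = x' /\ y = y'.
Proof. by move=> /quad_inj[/intr_inj -> /intr_inj ->]. Qed.

Lemma qintD x y x' y' : qint x y + qint x' y' = qint (x + x') (y + y').
Proof. by rewrite /qint quadD !rmorphD. Qed.

Lemma qintM x y x' y' :
  qint x y * qint x' y' = qint (x * x' + D%:Z * y * y') (x * y' + y * x').
Proof. by rewrite /qint quadM !rmorphD !rmorphM. Qed.

Lemma qint_r x : qint x 0 = x%:~R.
Proof. by rewrite /qint quad_r ratr_int. Qed.

Lemma qint_int x y : O (qint x y).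
Proof.
split; first by do 2!eexists.
rewrite /qint /quad !ratr_int rpredD ?rpredM ?Aint_int //.
apply: (@root_monic_Aint ('X^2 - (D%:R)%:P)).
- by rewrite /root !hornerE s2 subrr.
- by rewrite monicXnsubC.
- apply/polyOverP=> i; rewrite coefB coefXn coefC rpredB ?rpred_nat //.
  by case: ifP; rewrite ?rpred_nat ?rpred0.
Qed.

(** For [y != 0] the element is irrational, so [X^2 - 2 x X + qnorm x y] is its minimal polynomial,
    and [Aint] asks that polynomial to have integer coefficients. *)
Lemma trace_norm_int x y : quad x y \in Aint -> y != 0 ->
  2 * x \in Num.int /\ qnorm x y \in Num.int.
Proof.
move=> hz y0.
have [p [pE pm] pdiv] := minCpolyP (quad x y).
pose q : {poly rat} := 'X^2 - (2 * x) *: 'X + (qnorm x y)%:P.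
have qs : size ('X^2 - (2 * x) *: 'X : {poly rat}) = 3%N.
  rewrite size_polyDl ?size_polyXn // size_polyN.
  by rewrite (leq_ltn_trans (size_scale_leq _ _)) // size_polyX.
have qsz : size q = 3%N.
  by rewrite size_polyDl qs // (leq_ltn_trans (size_polyC_leq1 _)).
have qm : q \is monic.
  rewrite monicE lead_coefE qsz /q !coefE /=; apply/eqP; ring.
have pq : p %| q.
  have [N NE] : {N | qnorm x y = N} by exists (qnorm x y).
  rewrite -pdiv /root /q NE.
  rewrite !rmorphD rmorphN /= map_polyC /= map_polyZ map_polyXn map_polyX.
  rewrite !hornerE /= -NE /quad /qnorm rmorphB ?rmorphM ?rmorphXn /= ?rmorph_nat.
  move: s s2 => t <-; apply/eqP; ring.
have ps : size p = 3%N.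
  apply/eqP; rewrite eqn_leq -{1}qsz dvdp_leq ?monic_neq0 //=.
  rewrite ltnNge; apply/negP=> p2.
  have : root (map_poly ratr p) (quad x y) by rewrite pdiv.
  have p1 : (1 < size p)%N.
    rewrite ltnNge; apply/negP => /size1_polyC pc.
    move: pdiv => /(_ p); rewrite dvdpp pc map_polyC rootC /=.
    by rewrite fmorph_eq0 -polyC_eq0 -pc (negPf (monic_neq0 pm)).
  have {p1} {}p2 : size p = 2%N by apply/eqP; rewrite eqn_leq p2.
  have -> : p = 'X + (p`_0)%:P.
    apply/polyP => i; rewrite coefD coefX coefC.
    case: i => [|[|i]]; rewrite ?add0r ?addr0 //=.
      by move: pm; rewrite monicE lead_coefE p2 => /eqP.
    by rewrite nth_default // p2.
  rewrite /root rmorphD /= map_polyX map_polyC !hornerE /= => /eqP e.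
  have /quad_inj[_ /esym/eqP] : quad x y = quad (- p`_0) 0.
    by rewrite quad_r rmorphN; apply/eqP; rewrite -addr_eq0 e.
  by rewrite eq_sym (negPf y0).
have pqE : p = q.
  by apply/eqP; rewrite -eqp_monic // -dvdp_size_eqp // ps qsz.
move: hz; rewrite unfold_in pE pqE => /polyOverP h.
have rat_int r : (ratr r : algC) \in Num.int -> r \in @Num.int rat.
  case/intrP=> n; rewrite -(ratr_int _ n) => /eqP.
  rewrite (inj_eq (fmorph_inj (ratr : {rmorphism rat -> algC}))) => /eqP ->.
  by rewrite intr_int.
split; apply: rat_int.
- move: (h 1%N); rewrite coef_map /q !coefE /= add0r addr0 mulr1 rmorphN /=.
  by rewrite rpredN.
- by move: (h 0%N); rewrite coef_map /q !coefE /= mulr0 subr0 add0r.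
Qed.

Lemma ring_of_integersP z : O z <-> exists x y, z = qint x y.
Proof.
split; last by move=> [x [y ->]]; exact: qint_int.
move=> [[x [y ->]]]; rewrite -/(quad x y) => hz.
have [y0|y0] := eqVneq y 0.
  move: hz; rewrite y0 quad_r => hx.
  have /intrP[n] := Cint_rat_Aint (Crat_rat x) hx.
  by exists n, 0; rewrite qint_r.
have [/intrP[n nE] /intrP[N NE]] := trace_norm_int hz y0.
(* With [n = 2 x] and [w = 2 y] this reads [D w^2 = n^2 - 4 N]. As [D] is even, so is [n]; as
   [D = 2] mod 4, [w] is then even too. *)
have e : D%:R * (2 * y) ^+ 2 = (n ^+ 2 - 4 * N)%:~R.
  by rewrite rmorphB !rmorphM /= -nE -NE /qnorm; ring.
have [w wE] := rat_int_of_squarefree_mul sqf e.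
have e2 : D%:Z * w ^+ 2 = n ^+ 2 - 4 * N.
  by apply/eqP; rewrite -(eqr_int rat) -e wE rmorphM ?rmorphXn.
have [m Dm] : exists m, D = (4 * m + 2)%N by exists (D %/ 4)%N; lia.
have [a na] : exists a, n = 2 * a.
  have [a [h|h]] : exists a, n = 2 * a \/ n = 2 * a + 1 by exists (n %/ 2)%Z; lia.
    by exists a.
  by move: e2; rewrite h Dm; lia.
have [c wc] : exists c, w = 2 * c.
  have [c [h|h]] : exists c, w = 2 * c \/ w = 2 * c + 1 by exists (w %/ 2)%Z; lia.
    by exists c.
  by move: e2; rewrite h na Dm; lia.
exists a, c; rewrite /qint; congr quad; apply: (@mulfI _ 2) => //.
  by rewrite nE na rmorphM.
by rewrite wE wc rmorphM.
Qed.

End QuadField.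

(** * Diophantine approximation *)

Section Dirichlet.
Local Open Scope ring_scope.

(** Pigeonhole: of the [N + 1] fractional parts of [i x], [0 <= i <= N], two lie in the same one of
    [N] intervals of length [1 / N]; [t] is the difference of their indices. *)
Lemma dirichlet_approx (N : nat) (x : rat) : (0 < N)%N ->
  exists t : nat, exists q : int, (0 < t <= N)%N /\ `|t%:R * x - q%:~R| < N%:R^-1.
Proof.
case: N => // n _.
pose fl (i : nat) : int := Num.floor (i%:R * x).
pose fr (i : nat) : rat := i%:R * x - (fl i)%:~R.
have frP i : 0 <= fr i < 1.
  have /andP[h1 h2] := floor_itv (i%:R * x).
  by rewrite subr_ge0 h1 /= ltrBlDl; rewrite intrD in h2.
pose v (i : nat) : int := Num.floor (n.+1%:R * fr i).
have vP i : (v i)%:~R <= n.+1%:R * fr i < (v i)%:~R + 1.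
  by have := floor_itv (n.+1%:R * fr i); rewrite intrD mulr1z.
have v0 i : 0 <= v i.
  by rewrite floor_ge0 ?mulr_ge0 ?ler0n //; case/andP: (frP i).
have vn i : v i < n.+1.
  rewrite -(ltr_int rat); case/andP: (vP i) => h _; apply: le_lt_trans h _.
  by rewrite gtr_pMr ?ltr0n //; case/andP: (frP i).
pose f (i : 'I_n.+2) : 'I_n.+1 := inord `|v i|.
have /injectivePn[i [j ij fij]] : ~~ injectiveb f.
  apply/negP => /injectiveP /leq_card; by rewrite !card_ord ltnn.
have vij : v i = v j.
  have /(congr1 val) := fij; rewrite /f /= !inordK; last first.
  - by have := vn i; have := v0 i; lia.
  - by have := vn j; have := v0 j; lia.
  by have := v0 i; have := v0 j; lia.
wlog ji : i j ij {fij} vij / (j < i)%N.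
  move=> H; case: (ltngtP j i) => h; [exact: (H i j) | apply: (H j i) => // | ].
    by rewrite eq_sym.
  by case/eqP: ij; apply/val_inj.
exists (i - j)%N, (fl i - fl j); split; first by have := ltn_ord i; lia.
have -> : (i - j)%:R * x - (fl i - fl j)%:~R = fr i - fr j.
  by rewrite natrB 1?ltnW // rmorphB /fr /=; ring.
rewrite -[ltRHS]mul1r ltr_pdivlMr ?ltr0n // mulrC.
have [/andP[a1 a2] /andP[b1 b2]] := (vP i, vP j).
rewrite vij in a1 a2.
rewrite -[n.+1%:R]ger0_norm ?ler0n // -normrM mulrBr ltr_norml; apply/andP; split; lra.
Qed.

(** A substitute for Euclidean division. Approximating [y] to within [1 / D] and rounding [t x] down
    makes the norm a difference of two numbers in [[0, 1)]. *)
Lemma hurwitz_approx (D : nat) (x y : rat) : (1 < D)%N ->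
  exists t : nat, exists p q : int, (0 < t <= D)%N /\
    `|qnorm D (t%:R * x - p%:~R) (t%:R * y - q%:~R)| < 1.
Proof.
move=> D1; have [t [q [tD h]]] := @dirichlet_approx D y (ltnW D1).
exists t, (Num.floor (t%:R * x)), q; split=> //.
have := floor_itv (t%:R * x); rewrite intrD mulr1z => /andP[].
move: (t%:R * x) (Num.floor _)%:~R => X F h1 h2.
move: h; move: (t%:R * y - _) => b hb.
have D0 : 1 < D%:R :> rat by rewrite ltr1n.
have hDb : D%:R * b ^+ 2 < 1.
  have : D%:R * `|b| < 1 by rewrite -ltr_pdivlMl ?mulr1 //; lra.
  have := normr_ge0 b; rewrite -[b ^+ 2]real_normK ?num_real //.
  move: `|b| => c c0 hc; nra.
have hDb0 : 0 <= D%:R * b ^+ 2 by rewrite mulr_ge0 ?sqr_ge0 ?ler0n.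
have ha : (X - F) ^+ 2 < 1 by nra.
have ha0 := sqr_ge0 (X - F).
by rewrite /qnorm ltr_norml; apply/andP; split; lra.
Qed.

End Dirichlet.

(** * Finiteness of the class group *)

Section ClassGroup.
Local Open Scope ring_scope.
Local Open Scope classical_set_scope.

Variable D : nat.
Hypothesis D4 : (D %% 4 = 2)%N.
Hypothesis sqf : squarefree D.

Local Notation K := (quadfield D).
Local Notation O := (ring_of_integers K).
Local Notation qint := (qint D).
Local Notation quad := (quad D).
Let OP := ring_of_integersP D4 sqf.

Lemma qint_n (n : nat) : qint n 0 = n%:R.
Proof. by rewrite qint_r. Qed.

Lemma ideal_class_scale (I : set algC) (a : algC) : K a -> a != 0 ->
  ideal_class K [set a * x | x in I] = ideal_class K I.
Proof.
move=> Ka a0; apply/seteqP; split=> J /= [b [Kb b0 ->]].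
  exists (b * a); split; [exact: quadfieldM | by rewrite mulf_neq0 |].
  by rewrite image_comp; apply: eq_imagel => x _ /=; rewrite mulrA.
exists (b * a^-1); split.
- by apply: quadfieldM => //; exact: quadfieldV.
- by rewrite mulf_neq0 ?invr_eq0.
- rewrite image_comp; apply: eq_imagel => x _ /=.
  by rewrite mulrA mulfVK.
Qed.

Lemma ideal_class_refl (I : set algC) : ideal_class K I I.
Proof.
exists 1; split; rewrite ?oner_eq0 //.
  by exists 1, 0; rewrite -/(quad 1 0) quad_r rmorph1.
by rewrite -[LHS]image_id; apply: eq_imagel => x _; rewrite mul1r.
Qed.

Lemma qnorm_mul (R : comPzRingType) (x y u v : R) :
  qnorm D (x * u + D%:R * y * v) (x * v + y * u) = qnorm D x y * qnorm D u v.
Proof. rewrite /qnorm; ring. Qed.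

Lemma qnorm_int (x y : int) : qnorm D x%:~R y%:~R = (qnorm D x y)%:~R :> rat.
Proof. by rewrite /qnorm rmorphB !rmorphM /= natz. Qed.

(** Take [w] in [I], nonzero, with the norm of [d w] least in absolute value. For [u] in [I],
    [hurwitz_approx] applied to [u / w] gives [t u - om w] in [I] of smaller norm, hence zero. So
    [t u / w] is integral with [t] dividing [D!], and [D! / w] is the required multiplier. *)
Lemma ideal_reduction (I : set algC) : fractional_ideal K I ->
  exists a, [/\ K a, a != 0, [set a * x | x in I] `<=` O &
    [set a * x | x in I] (D`!)%:R].
Proof.
case=> IK [z Iz z0] IA IM [d [Od d0 dI]].
have Kd : K d by case: Od.
pose P n := `[< exists x y : int, exists2 w, I w &
  d * w = qint x y /\ d * w != 0 /\ `|qnorm D x y|%N = n >].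
have exP : exists n, P n.
  have /OP[x [y e]] := dI z Iz.
  exists `|qnorm D x y|%N; apply/asboolP; exists x, y, z => //.
  by split=> //; rewrite mulf_neq0.
case: (ex_minnP exP) => n /asboolP[x [y [w Iw [dwE [dw0 nE]]]]] minn.
have w0 : w != 0 by apply: contraNneq dw0 => ->; rewrite mulr0.
have Kw : K w by exact: IK.
exists (D`!%:R / w); split.
- apply: quadfieldM; last exact: quadfieldV.
  by exists D`!%:R, 0; rewrite -/(quad _ _) quad_r rmorph_nat.
- by rewrite mulf_neq0 ?invr_eq0 // pnatr_eq0 -lt0n fact_gt0.
- move=> _ [u Iu <-].
  have [X [Y g]] : K (u / w) by apply: quadfieldM; [exact: IK | exact: quadfieldV].
  have {}g : u = w * quad X Y by rewrite /quad -g mulrC divfK.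
  have [|t [p [q [tD hN]]]] := @hurwitz_approx D X Y; first by lia.
  pose om := qint p q; pose de := t%:R * u - om * w.
  have Ide : I de.
    apply: (IA); first by apply: IM => //; rewrite -[t%:R]qint_n; exact: qint_int.
    by rewrite -mulNr; apply: IM => //; rewrite /om /qint quadN -!rmorphN; exact: qint_int.
  have deE : de = w * quad (t%:R * X - p%:~R) (t%:R * Y - q%:~R).
    by rewrite /de /om /qint g /quad !rmorphB !rmorphM /= !rmorph_nat; ring.
  have de0 : de = 0.
    apply/eqP; apply/negPn/negP => de0.
    have /OP[x' [y' e]] := dI _ Ide.
    have : P `|qnorm D x' y'|%N.
      by apply/asboolP; exists x', y', de => //; rewrite mulf_neq0.
    move/minn; apply/negP; rewrite -ltnNge -nE.
    rewrite -ltz_nat !abszE -(ltr_int rat) !intr_norm -!qnorm_int.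
    have : quad x'%:~R y'%:~R = qint x y * quad (t%:R * X - p%:~R) (t%:R * Y - q%:~R).
      by rewrite -dwE -mulrA -deE e.
    rewrite quadM => /(quad_inj D4 sqf)[-> ->]; rewrite qnorm_mul normrM.
    rewrite gtr_pMr // normr_gt0; apply: contra dw0 => /eqP/(qnorm_eq0 D4 sqf)[ex ey].
    by rewrite dwE /qint ex ey quad_r rmorph0.
  have tu : t%:R * u = om * w by apply/eqP; rewrite -subr_eq0 -/de de0.
  have /dvdnP[c cE] : (t %| D`!)%N by rewrite dvdn_fact.
  have -> : D`!%:R / w * u = c%:R * om.
    have -> : om = t%:R * u / w by rewrite tu mulfK.
    by rewrite cE natrM; field.
  rewrite -[c%:R]qint_n qintM; exact: qint_int.
- by exists w => //; rewrite divfK.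
Qed.

(** Since [M] lies in [J], so does [M O]; thus [J] is a union of cosets of [M O], determined by the
    residues it contains. *)
Lemma ideal_of_residues (J : set algC) (M : nat) : (0 < M)%N ->
  (forall x y, J x -> J y -> J (x + y)) ->
  (forall a x, O a -> J x -> J (a * x)) -> J `<=` O -> J M%:R ->
  J = [set z | exists x y : int, exists2 i : 'I_M * 'I_M,
        J (qint i.1 i.2) & z = qint i.1 i.2 + M%:R * qint x y].
Proof.
move=> M0 JA JM JO JMM; apply/seteqP; split=> z /=; last first.
  by move=> [x [y [i Ji ->]]]; apply: JA => //; rewrite mulrC; apply: JM => //; exact: qint_int.
move=> Jz; have /OP[x [y zE]] := JO z Jz.
have r (u : int) : exists i : 'I_M, exists v : int, u = i%:Z + M%:Z * v.
  have h : (`|(u %% M)%Z|%N < M)%N by rewrite -ltz_nat gez0_abs ?modz_ge0 ?ltz_pmod //; lia.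
  exists (Ordinal h), (u %/ M)%Z => /=.
  rewrite gez0_abs; first by rewrite {1}(divz_eq u M) addrC mulrC.
  by apply: modz_ge0; lia.
have [i [x' xE]] := r x; have [j [y' yE]] := r y.
have zE2 : z = qint i j + M%:R * qint x' y'.
  by rewrite zE xE yE -[M%:R]qint_n qintM qintD; congr qint; ring.
exists x', y', (i, j) => //=.
have -> : qint i j = z + qint (- x') (- y') * M%:R.
  by rewrite zE2 -[M%:R]qint_n !qintM !qintD; congr qint; ring.
by apply: JA => //; apply: JM => //; exact: qint_int.
Qed.

Lemma finite_class_group : finite_set (class_group K).
Proof.
set M := D`!; have M0 : (0 < M)%N by exact: fact_gt0.
pose F (S : set ('I_M * 'I_M)) : set algC := [set z | exists x y : int,
  exists2 i, S i & z = qint i.1 i.2 + M%:R * qint x y].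
(* Not every [S] yields an ideal; it suffices that this finite image contains the class group. *)
have h : finite_set [set ideal_class K (F [set` S]) | S in [set: {set 'I_M * 'I_M}]].
  by apply: finite_image; exact: finite_finset.
apply: sub_finite_set h => C [I fI ->].
have [a [Ka a0 JO JM]] := ideal_reduction fI.
set J := [set a * x | x in I] in JO JM.
have [_ _ IA IM _] := fI.
have JE : J = F [set i : 'I_M * 'I_M | J (qint i.1 i.2)].
  apply: ideal_of_residues => //.
  - by move=> _ _ [x Ix <-] [y Iy <-]; exists (x + y); [exact: IA | rewrite mulrDr].
  - by move=> c _ Oc [x Ix <-]; exists (c * x); [exact: IM | rewrite mulrCA].
exists (finset (fun i : 'I_M * 'I_M => `[< J (qint i.1 i.2) >])) => //=.
rewrite -(ideal_class_scale I Ka a0) -/J [in RHS]JE; congr (ideal_class K (F _)).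
by apply/seteqP; split=> i /=; rewrite inE => /asboolP.
Qed.

End ClassGroup.

(** * The prime above 2 *)

Section ClassNumber.
Local Open Scope ring_scope.
Local Open Scope classical_set_scope.

Lemma class_number_gt1 (K I J : set algC) : finite_set (class_group K) ->
  fractional_ideal K I -> fractional_ideal K J -> ideal_class K I <> ideal_class K J ->
  (1 < class_number K)%N.
Proof.
move=> fin fI fJ IJ; rewrite /class_number.
have <- : #|` [fset ideal_class K I; ideal_class K J]%fset| = 2%N.
  by rewrite cardfs2; case: eqP.
apply: fsubset_leq_card; apply/fsubsetP => C; rewrite in_fset2 in_fset_set //.
by case/orP=> /eqP ->; rewrite inE; [exists I | exists J].
Qed.

Variable D : nat.
Hypothesis D4 : (D %% 4 = 2)%N.
Hypothesis sqf : squarefree D.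
Local Notation K := (quadfield D).
Local Notation O := (ring_of_integers K).
Local Notation qint := (qint D).
Let OP := ring_of_integersP D4 sqf.

Lemma fractional_ideal_in (I : set algC) : I `<=` O -> (exists2 x, I x & x != 0) ->
  (forall x y, I x -> I y -> I (x + y)) -> (forall a x, O a -> I x -> I (a * x)) ->
  fractional_ideal K I.
Proof.
move=> IO I0 IA IM; split=> //; first by move=> x /IO[].
exists 1; split; rewrite ?oner_eq0 //; last by move=> x /IO; rewrite mul1r.
by have := qint_int D 1 0; rewrite qint_r.
Qed.

Lemma fractional_ideal_ring_of_integers : fractional_ideal K O.
Proof.
apply: fractional_ideal_in => //.
- by exists 1; rewrite ?oner_eq0 // -[1]/(1%:R) -(qint_n D 1); exact: qint_int.
- by move=> _ _ /OP[x [y ->]] /OP[x' [y' ->]]; rewrite qintD; exact: qint_int.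
- by move=> _ _ /OP[x [y ->]] /OP[x' [y' ->]]; rewrite qintM; exact: qint_int.
Qed.

(* This is the ideal (2, sqrt D), because D is even. *)
Definition prime_over_two : set algC := [set z | exists x y : int, z = qint (2 * x) y].

Lemma fractional_ideal_prime_over_two : fractional_ideal K prime_over_two.
Proof.
apply: fractional_ideal_in.
- by move=> _ [x [y ->]]; exact: qint_int.
- exists 2; last by rewrite pnatr_eq0.
  by exists 1, 0; rewrite qint_r.
- move=> _ _ [x [y ->]] [x' [y' ->]]; exists (x + x'), (y + y').
  by rewrite qintD mulrDr.
- move=> _ _ /OP[a [b ->]] [x [y ->]].
  have [m Dm] : exists m, D = (2 * m)%N by exists (D %/ 2)%N; lia.
  exists (a * x + m%:Z * b * y), (a * y + 2 * b * x).
  by rewrite qintM {2}Dm PoszM; congr qint; ring.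
Qed.

(** The ideal is then [a O]. The norm of [a = 2 x + y sqrt D] is even and divides the norms 4 of 2
    and [-D] of [sqrt D], whose gcd is 2 because [D = 2] mod 4. *)
Lemma prime_over_two_norm : ideal_class K prime_over_two = ideal_class K O ->
  exists x y : int, `|x ^+ 2 - D%:Z * y ^+ 2| = 2.
Proof.
move=> e; have := ideal_class_refl D prime_over_two; rewrite e => -[a [Ka a0 PE]].
have [x [y aE]] : prime_over_two a.
  by rewrite PE; exists 1; rewrite ?mulr1 // -[1]/(1%:~R) -(qint_r D); exact: qint_int.
have [_ /OP[p [q ->]]] : [set a * x | x in O] 2.
  by rewrite -PE; exists 1, 0; rewrite qint_r.
rewrite aE -(qint_n D 2) qintM => /(qint_inj D4 sqf)[e1 e2].
have [_ /OP[u [v ->]]] : [set a * x | x in O] (qint 0 1).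
  by rewrite -PE; exists 0, 1; rewrite mulr0.
rewrite aE qintM => /(qint_inj D4 sqf)[e3 e4].
exists (2 * x), y.
have [m Dm] : exists m, D = (4 * m + 2)%N by exists (D %/ 4)%N; lia.
pose N (s t : int) := s ^+ 2 - D%:Z * t ^+ 2.
have NM s t s' t' : N (s * s' + D%:Z * t * t') (s * t' + t * s') = N s t * N s' t'.
  by rewrite /N; ring.
have h1 : N (2 * x) y * N p q = 4 by rewrite -NM e1 e2 /N; ring.
have h2 : N (2 * x) y * N u v = - D%:Z by rewrite -NM e3 e4 /N; ring.
rewrite -/(N (2 * x) y).
have [c cE] : exists c, N (2 * x) y = 2 * c.
  by exists (2 * x ^+ 2 - (2 * m%:Z + 1) * y ^+ 2); rewrite /N Dm PoszD PoszM; ring.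
have c1 : c * N p q = 2 by lia.
have c2 : c * N u v = - (2 * m%:Z + 1) by lia.
(* Bezout for the coprime integers 2 and [2 m + 1]: [(2 m + 1) - m 2 = 1], so [c] is a unit. *)
have c3 : c * (- N u v - m%:Z * N p q) = 1 by rewrite mulrBr mulrN mulrCA c1 c2; ring.
have : `|c|%N = 1%N.
  apply/eqP; rewrite -dvdn1; apply/dvdnP.
  by exists `|(- N u v - m%:Z * N p q)%R|%N; rewrite -abszM mulrC c3.
by rewrite cE; lia.
Qed.

End ClassNumber.

(** * Nontriviality of the class of the prime above 2 for [D(b, s, k)] *)

Theorem theorem1p1 (b s k : nat) (hs : 0 < s) (hk : 0 < k)
    (hodd : odd (b + s))
    (D : nat)
    (hD : D = (4 * b * s + 1) ^ k + (b * (4 * b * s + 1) ^ k + s) ^ 2)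
    (hsqf : squarefree D)
    (hb : 41 * 61 * 175 * 1861 %| b) :
  ~ (b = 0 /\ s = 1) -> 1 < class_number (quadfield D).
Proof.
move=> hbs.
have A4 : (4 * b * s + 1) ^ k %% 4 = 1.
  by rewrite -modnXm -mulnA mulnC modnMDl modnXm exp1n.
(* [b A^k + s] has the parity of [b + s], as [A] is odd; so its square is 1 mod 4, like [A^k]. *)
have D4 : D %% 4 = 2.
  rewrite hD -modnDm A4.
  have [c cE] : exists c, b * (4 * b * s + 1) ^ k + s = 2 * c + 1.
    exists (b * (4 * b * s + 1) ^ k + s)./2.
    have : odd (b * (4 * b * s + 1) ^ k + s).
      by rewrite oddD oddM oddX oddD !oddM /= orbT andbT -oddD.
    by lia.
  rewrite cE -mulnn; lia.
(* The excluded pair [b = 0], [s = 1] is the one giving [D = 2]; otherwise [b A^k + s >= 2]. *)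
have D2 : 2 < D.
  have Ak : 0 < (4 * b * s + 1) ^ k by rewrite expn_gt0 addn1.
  have w1 : 1 < b * (4 * b * s + 1) ^ k + s.
    have [b0|b0] := posnP b; last by rewrite -(addn1 1) leq_add // muln_gt0 b0.
    by rewrite b0; case: (s) hs hbs => [|[|]] // _ []; split.
  by rewrite hD -mulnn -[3]/(1 + 2) leq_add // (leq_trans _ (leq_mul w1 w1)).
apply: (class_number_gt1 (finite_class_group D4 hsqf) (I := prime_over_two D)).
- exact: fractional_ideal_prime_over_two.
- exact: fractional_ideal_ring_of_integers.
move=> /(prime_over_two_norm D4 hsqf)[x [y /eqP]]; apply/negP.
have [m Dm] : exists m, D = 2 * m by exists (D %/ 2); lia.
have m1 : 1 < m by lia.
have [||a [c]] := @pell_neg_solvable (4 * b * s + 1)%N b s k hk; [lia | lia |].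
have -> : ((4 * b * s + 1)%N%:Z ^+ k +
    (b%:Z * (4 * b * s + 1)%N%:Z ^+ k + s%:Z) ^+ 2 = (2 * m)%N%:Z)%R.
  by rewrite -Dm hD !PoszD PoszM -!rmorphXn.
by rewrite Dm in hsqf *; exact: pell_no_norm_two.
Qed.
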